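(* Assume that there are positive constants $K_1,K_2$ such that, for $\alpha\ne\alpha'$ in $\{1,2\}$, $$f_\alpha(x,y,t,0_\alpha,u_{\alpha'})\le0\ \text{ for all real } u_{\alpha'}\ge0,\qquad f_\alpha(x,y,t,K_\alpha,0_{\alpha'})\ge0,\qquad (x,y,t)\in\overline Q_T,$$ $0\le g_\alpha\le K_\alpha$ on $\partial Q_T$ and $0\le\psi_\alpha\le K_\alpha$ on $\overline\omega$. Let, for $p\in\overline\Omega^h$ and $\alpha=1,2$, $$\widehat U_\alpha(p,t_m)=\begin{cases}\psi_\alpha(p),&m=0,\\ 0,&m\ge1,\end{cases}\qquad \widetilde U_\alpha(p,t_m)=\begin{cases}\psi_\alpha(p),&m=0,\\ K_\alpha,&m\ge1.\end{cases}$$ Then $\widehat U$ and $\widetilde U$ are ordered lower and upper solutions (nonincreasing case) of the scheme (NDS).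
   Context: Data: $l_1,l_2,T>0$, $\omega=(0,l_1)\times(0,l_2)$, $Q_T=\omega\times(0,T]$, $\partial Q_T=\partial\omega\times(0,T]$; for $\alpha=1,2$: constants $\varepsilon_\alpha>0$, smooth functions $f_\alpha(x,y,t,u)$, $u=(u_1,u_2)$, $g_\alpha$ on $\partial Q_T$, $\psi_\alpha$ on $\overline\omega$, and smooth nonnegative $v_{\alpha,1},v_{\alpha,2}$ on $\overline Q_T$. Vector inequalities are componentwise. Convention: $f_\alpha(x,y,t,a_\alpha,b_{\alpha'})$ is the value of $f_\alpha$ when $u_\alpha=a_\alpha$ and $u_{\alpha'}=b_{\alpha'}$, where $\alpha'\neq\alpha$; $0_\alpha$ means $u_\alpha=0$. Mesh: $x_i=ih_x$ ($0\le i\le N_x$, $h_x=l_1/N_x$), $y_j=jh_y$ ($0\le j\le N_y$, $h_y=l_2/N_y$), $t_m=m\tau$ ($0\le m\le N_\tau$, $\tau=T/N_\tau$). $\overline\Omega^h$ is the set of all $p=(x_i,y_j)$, $\Omega^h$ the interior ones, $\partial\Omega^h=\overline\Omega^h\setminus\Omega^h$. ''$m\ge1$'' means $1\le m\le N_\tau$. Operator: $\mathcal L^h_\alpha U_\alpha=-\varepsilon_\alpha(D_x^2U_\alpha+D_y^2U_\alpha)+v_{\alpha,1}D_x^1U_\alpha+v_{\alpha,2}D_y^1U_\alpha$, with $D_x^2,D_y^2$ the standard second central differences and $D_x^1,D_y^1$ the backward differences. Scheme (NDS): for $\alpha=1,2$, $m\ge1$, $(\mathcal L^h_\alpha(p,t_m)+\tau^{-1})U_\alpha(p,t_m)+f_\alpha(p,t_m,U)-\tau^{-1}U_\alpha(p,t_{m-1})=0$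 for $p\in\Omega^h$; $U(p,t_m)=g(p,t_m)$ for $p\in\partial\Omega^h$; $U(p,0)=\psi(p)$ for $p\in\overline\Omega^h$. Ordered upper and lower solutions (nonincreasing case): $\widetilde U,\widehat U$ are such if, for all $m\ge1$ and $\alpha\ne\alpha'$: $\widetilde U\ge\widehat U$ on $\overline\Omega^h$; on $\Omega^h$, $(\mathcal L^h_\alpha+\tau^{-1})\widetilde U_\alpha(p,t_m)+f_\alpha(p,t_m,\widetilde U_\alpha,\widehat U_{\alpha'})-\tau^{-1}\widetilde U_\alpha(p,t_{m-1})\ge0$ and $(\mathcal L^h_\alpha+\tau^{-1})\widehat U_\alpha(p,t_m)+f_\alpha(p,t_m,\widehat U_\alpha,\widetilde U_{\alpha'})-\tau^{-1}\widehat U_\alpha(p,t_{m-1})\le0$; $\widehat U\le g\le\widetilde U$ on $\partial\Omega^h$; and $\widehat U(p,0)\le\psi(p)\le\widetilde U(p,0)$ on $\overline\Omega^h$. *)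

(* Defs.v *)
From HB Require Import structures.
From mathcomp Require Import all_boot all_order all_algebra.
From mathcomp Require Import all_classical all_reals all_analysis.

Set Implicit Arguments.
Unset Strict Implicit.
Unset Printing Implicit Defensive.

Import Order.TTheory GRing.Theory Num.Theory numFieldNormedType.Exports.

Local Open Scope classical_set_scope.
Local Open Scope ring_scope.

(* C^k on an open set O.  Derivatives are taken along all vectors v rather than
   along a basis, so that products and row vectors are covered uniformly; on
   the finite-dimensional V used below this is the usual notion. *)
Fixpoint Ck {R : realType} {V : normedModType R} (k : nat) (O : set V)
    (F : V -> R) : Prop :=
  (forall x, O x -> {for x, continuous F}) /\
  if k is k'.+1 then
    forall v : V, (forall x, O x -> derivable F x v) /\
                  Ck k' O (fun x => 'D_v F x)
  else True.

(* Smoothness on an arbitrary set A (closed boxes and boundaries below):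
   F agrees on A with a function that is C^oo on an open neighbourhood of A. *)
Definition smooth_on {R : realType} {V : normedModType R} (A : set V)
    (F : V -> R) : Prop :=
  exists (O : set V) (G : V -> R),
    [/\ open O, A `<=` O, forall k, Ck k O G & forall x, A x -> F x = G x].

Section Domains.
Context {R : realType} (l1 l2 T : R).

Definition omega : set (R * R) := `]0, l1[ `*` `]0, l2[.
Definition omega_bar : set (R * R) := `[0, l1] `*` `[0, l2].
Definition omega_bd : set (R * R) := omega_bar `\` omega.
Definition QT_bar : set (R * R * R) := omega_bar `*` `[0, T].
Definition QT_bd : set (R * R * R) := omega_bd `*` `]0, T].

End Domains.

(* The components alpha = 1, 2 are indexed by 'I_2.  Functions are total in
   Rocq; only their values on the sets named in the laws are meaningful. *)
Record system (R : realType) := System {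
  l1 : R;
  l2 : R;
  T : R;
  eps : 'I_2 -> R;
  v1 : 'I_2 -> R * R * R -> R;
  v2 : 'I_2 -> R * R * R -> R;
  f : 'I_2 -> R * R * R * 'rV[R]_2 -> R;
  g : 'I_2 -> R * R * R -> R;
  psi : 'I_2 -> R * R -> R;
  l1_gt0 : 0 < l1;
  l2_gt0 : 0 < l2;
  T_gt0 : 0 < T;
  eps_gt0 : forall a, 0 < eps a;
  v1_smooth : forall a, smooth_on (QT_bar l1 l2 T) (v1 a);
  v2_smooth : forall a, smooth_on (QT_bar l1 l2 T) (v2 a);
  v1_ge0 : forall a q, QT_bar l1 l2 T q -> 0 <= v1 a q;
  v2_ge0 : forall a q, QT_bar l1 l2 T q -> 0 <= v2 a q;
  f_smooth : forall a, smooth_on (QT_bar l1 l2 T `*` [set: 'rV[R]_2]) (f a);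
  g_smooth : forall a, smooth_on (QT_bd l1 l2 T) (g a);
  psi_smooth : forall a, smooth_on (omega_bar l1 l2) (psi a)
}.

Record mesh := Mesh {
  Nx : nat;
  Ny : nat;
  Nt : nat;
  Nx_gt0 : (0 < Nx)%N;
  Ny_gt0 : (0 < Ny)%N;
  Nt_gt0 : (0 < Nt)%N
}.

(* The vector u with u_a = s and u_a' = r for a' != a. *)
Definition mixed {R : realType} (a : 'I_2) (s r : R) : 'rV[R]_2 :=
  \row_b (if b == a then s else r).

(* U a i j m is the value of U_a at (x_i, y_j, t_m); values at indices outside
   the mesh are never used. *)
Definition mesh_function (R : realType) := 'I_2 -> nat -> nat -> nat -> R.

Section Scheme.
Context {R : realType} (S : system R) (M : mesh).

Definition hx : R := l1 S / (Nx M)%:R.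
Definition hy : R := l2 S / (Ny M)%:R.
Definition tau : R := T S / (Nt M)%:R.

Definition node (i j : nat) : R * R := (i%:R * hx, j%:R * hy).
Definition time (m : nat) : R := m%:R * tau.

(* A mesh node is represented by its pair of indices (i, j). *)
Definition Omega_bar (i j : nat) : bool := (i <= Nx M)%N && (j <= Ny M)%N.
Definition Omega_int (i j : nat) : bool :=
  (0 < i < Nx M)%N && (0 < j < Ny M)%N.
Definition Omega_bd (i j : nat) : bool := Omega_bar i j && ~~ Omega_int i j.

Definition Dx2 (w : nat -> nat -> R) i j : R :=
  (w i.+1 j - 2 * w i j + w i.-1 j) / hx ^+ 2.
Definition Dy2 (w : nat -> nat -> R) i j : R :=
  (w i j.+1 - 2 * w i j + w i j.-1) / hy ^+ 2.
Definition Dx1 (w : nat -> nat -> R) i j : R := (w i j - w i.-1 j) / hx.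
Definition Dy1 (w : nat -> nat -> R) i j : R := (w i j - w i j.-1) / hy.

Definition Lh (a : 'I_2) (m : nat) (w : nat -> nat -> R) i j : R :=
  - eps S a * (Dx2 w i j + Dy2 w i j)
  + v1 S a (node i j, time m) * Dx1 w i j
  + v2 S a (node i j, time m) * Dy1 w i j.

(* Left-hand side of the a-th difference equation for U_a at (x_i, y_j, t_m),
   with the reaction term evaluated at the vector u. *)
Definition nds_lhs (a : 'I_2) (U : mesh_function R) (u : 'rV[R]_2) i j m : R :=
  Lh a m (fun i' j' => U a i' j' m) i j + tau^-1 * U a i j m
  + f S a (node i j, time m, u) - tau^-1 * U a i j m.-1.

Definition nds_solution (U : mesh_function R) : Prop :=
  [/\ forall a i j m, (1 <= m <= Nt M)%N -> Omega_int i j ->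
        nds_lhs a U (\row_b U b i j m) i j m = 0,
      forall a i j m, (1 <= m <= Nt M)%N -> Omega_bd i j ->
        U a i j m = g S a (node i j, time m)
    & forall a i j, Omega_bar i j -> U a i j 0 = psi S a (node i j)].

(* Ordered lower (Uh) and upper (Ut) solutions, nonincreasing case. *)
Definition ordered_lower_upper (Uh Ut : mesh_function R) : Prop :=
  [/\ forall a i j m, (1 <= m <= Nt M)%N -> Omega_bar i j ->
        Uh a i j m <= Ut a i j m,
      forall a a' i j m, a != a' -> (1 <= m <= Nt M)%N -> Omega_int i j ->
        0 <= nds_lhs a Ut (mixed a (Ut a i j m) (Uh a' i j m)) i j m /\
        nds_lhs a Uh (mixed a (Uh a i j m) (Ut a' i j m)) i j m <= 0,
      forall a i j m, (1 <= m <= Nt M)%N -> Omega_bd i j ->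
        Uh a i j m <= g S a (node i j, time m) <= Ut a i j m
    & forall a i j, Omega_bar i j ->
        Uh a i j 0 <= psi S a (node i j) <= Ut a i j 0].

End Scheme.

(* Main.v *)
Require Import Defs.
From mathcomp Require Import all_boot all_order all_algebra.
From mathcomp Require Import all_classical all_reals all_analysis.
From mathcomp Require Import ring.

(** At every time level [m >= 1] both candidates are constant in space, so all
    difference quotients in the elliptic operator vanish and the left-hand side
    of the scheme collapses to
    [tau^-1 * (c - U a i j m.-1) + f_a] ([nds_lhs_const]), where [c] is [0] for
    the lower and [K a] for the upper candidate.  The previous level of either
    candidate has its values in [[0, K a]]: for [m = 1] this is the bound on the
    initial datum, afterwards the value is [c] itself.  Hence the time
    difference is nonpositive for [c = 0] and nonnegative for [c = K a], which
    is exactly the sign that the hypotheses give to the reaction term at the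
    mixed arguments [(0, K a')] and [(K a, 0)].  The comparison with the boundary
    and initial data is the pair of assumed bounds, once mesh nodes have been
    located in the closed rectangle or on its boundary. *)

Import Order.TTheory GRing.Theory Num.Theory.

Local Open Scope ring_scope.

Section UniformGrid.
Context {R : realFieldType} (l : R) (N : nat).
Hypotheses (l_gt0 : 0 < l) (N_gt0 : (0 < N)%N).

Lemma grid_step_gt0 : 0 < l / N%:R.
Proof. by rewrite divr_gt0 // ltr0n. Qed.

Lemma grid_end : l = N%:R * (l / N%:R).
Proof. by rewrite mulrC divfK // pnatr_eq0 -lt0n. Qed.

Lemma grid_ge0 i : 0 <= i%:R * (l / N%:R).
Proof. by rewrite mulr_ge0 // ltW // grid_step_gt0. Qed.

Lemma grid_gt0 i : (0 < i%:R * (l / N%:R)) = (0 < i)%N.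
Proof. by rewrite pmulr_lgt0 ?grid_step_gt0 // ltr0n. Qed.

Lemma grid_le i : (i%:R * (l / N%:R) <= l) = (i <= N)%N.
Proof. by rewrite [leRHS]grid_end ler_pM2r ?grid_step_gt0 // ler_nat. Qed.

Lemma grid_lt i : (i%:R * (l / N%:R) < l) = (i < N)%N.
Proof. by rewrite [ltRHS]grid_end ltr_pM2r ?grid_step_gt0 // ltr_nat. Qed.

End UniformGrid.

Section Nodes.
Context {R : realType} (S : system R) (M : mesh).

Lemma Omega_int_bar i j : Omega_int M i j -> Omega_bar M i j.
Proof. by case/andP=> /andP[_ /ltnW iN] /andP[_ /ltnW jN]; apply/andP. Qed.

Lemma tau_gt0 : 0 < tau S M.
Proof. by rewrite grid_step_gt0 ?T_gt0 ?Nt_gt0. Qed.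

Lemma node_omega_bar {i j} :
  Omega_bar M i j -> omega_bar (l1 S) (l2 S) (node S M i j).
Proof.
case/andP=> iN jN; split; rewrite /= in_itv /=.
  by rewrite grid_ge0 ?grid_le ?l1_gt0 ?Nx_gt0.
by rewrite grid_ge0 ?grid_le ?l2_gt0 ?Ny_gt0.
Qed.

Lemma node_omega i j :
  omega (l1 S) (l2 S) (node S M i j) -> Omega_int M i j.
Proof.
case; rewrite /= !in_itv /= => ihx jhy; apply/andP; split.
  by move: ihx; rewrite grid_gt0 ?grid_lt ?l1_gt0 ?Nx_gt0.
by move: jhy; rewrite grid_gt0 ?grid_lt ?l2_gt0 ?Ny_gt0.
Qed.

Lemma node_time_QT_bar {i j m} : Omega_bar M i j -> (m <= Nt M)%N ->
  QT_bar (l1 S) (l2 S) (T S) (node S M i j, time S M m).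
Proof.
move=> ij mN; split; first exact: node_omega_bar.
by rewrite /= in_itv /= grid_ge0 ?grid_le ?T_gt0 ?Nt_gt0.
Qed.

Lemma node_time_QT_bd {i j m} : Omega_bd M i j -> (1 <= m <= Nt M)%N ->
  QT_bd (l1 S) (l2 S) (T S) (node S M i j, time S M m).
Proof.
case/andP=> ij /negP not_int /andP[m_gt0 mN]; split.
  by split; [exact: node_omega_bar | move=> /node_omega].
by rewrite /= in_itv /= grid_gt0 ?grid_le ?T_gt0 ?Nt_gt0 // m_gt0.
Qed.

(** The five-point stencil of an interior node stays inside the mesh, so
    constancy on the mesh nodes is enough to annihilate every difference. *)
Lemma Lh_const a m (w : nat -> nat -> R) c i j :
    (forall i' j', Omega_bar M i' j' -> w i' j' = c) -> Omega_int M i j ->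
  Lh S M a m w i j = 0.
Proof.
move=> wc /andP[/andP[i_gt0 iN] /andP[j_gt0 jN]].
have [iN' jN'] := (ltnW iN, ltnW jN).
rewrite /Lh /Dx2 /Dy2 /Dx1 /Dy1 !wc /Omega_bar ?iN ?jN ?iN' ?jN' //=.
- ring.
- by rewrite (leq_trans (leq_pred j)).
- by rewrite (leq_trans (leq_pred i)).
Qed.

Lemma nds_lhs_const a (U : mesh_function R) u c i j m :
    (forall i' j', Omega_bar M i' j' -> U a i' j' m = c) -> Omega_int M i j ->
  nds_lhs S M a U u i j m =
    (tau S M)^-1 * (c - U a i j m.-1) + f S a (node S M i j, time S M m, u).
Proof.
move=> Uc ij; rewrite /nds_lhs (Lh_const _ _ _ c) // Uc ?Omega_int_bar //.
ring.
Qed.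

End Nodes.

Theorem theorem16 (R : realType) (S : system R) (M : mesh) (K : 'I_2 -> R)
    (K_gt0 : forall a, 0 < K a)
    (f_lower : forall a q (r : R), QT_bar (l1 S) (l2 S) (T S) q -> 0 <= r ->
       f S a (q, mixed a 0 r) <= 0)
    (f_upper : forall a q, QT_bar (l1 S) (l2 S) (T S) q ->
       0 <= f S a (q, mixed a (K a) 0))
    (g_bounds : forall a q, QT_bd (l1 S) (l2 S) (T S) q -> 0 <= g S a q <= K a)
    (psi_bounds : forall a p, omega_bar (l1 S) (l2 S) p ->
       0 <= psi S a p <= K a)
    (Uh Ut : mesh_function R)
    (Uh_def : forall a i j m, Omega_bar M i j -> (m <= Nt M)%N ->
       Uh a i j m = if m == 0%N then psi S a (node S M i j) else 0)
    (Ut_def : forall a i j m, Omega_bar M i j -> (m <= Nt M)%N ->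
       Ut a i j m = if m == 0%N then psi S a (node S M i j) else K a) :
  ordered_lower_upper S M Uh Ut.
Proof.
have Uh0 a i j m : (1 <= m <= Nt M)%N -> Omega_bar M i j -> Uh a i j m = 0.
  by case: m => // m mN ij; rewrite Uh_def.
have UtK a i j m : (1 <= m <= Nt M)%N -> Omega_bar M i j -> Ut a i j m = K a.
  by case: m => // m mN ij; rewrite Ut_def.
have Uh_ge0 a i j m : Omega_bar M i j -> (m <= Nt M)%N -> 0 <= Uh a i j m.
  move=> ij mN; rewrite Uh_def //; case: ifP => // _.
  by have /andP[] := psi_bounds a _ (node_omega_bar S M ij).
have Ut_leK a i j m : Omega_bar M i j -> (m <= Nt M)%N -> Ut a i j m <= K a.
  move=> ij mN; rewrite Ut_def //; case: ifP => // _.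
  by have /andP[] := psi_bounds a _ (node_omega_bar S M ij).
have tauV_ge0 : 0 <= (tau S M)^-1 by rewrite invr_ge0 ltW // tau_gt0.
split=> [a i j m mN ij|a a' i j m _ mN ij|a i j m mN ij|a i j ij].
- by rewrite Uh0 // UtK // ltW.
- have ij' := Omega_int_bar M _ _ ij.
  have /andP[_ m_le] := mN.
  have m1_le : (m.-1 <= Nt M)%N := leq_trans (leq_pred m) m_le.
  have q_in := node_time_QT_bar S M ij' m_le.
  rewrite !Uh0 // !UtK //; split.
    rewrite (nds_lhs_const _ _ _ _ _ (K a)) //; last by move=> *; exact: UtK.
    by rewrite addr_ge0 ?f_upper // mulr_ge0 // subr_ge0 Ut_leK.
  rewrite (nds_lhs_const _ _ _ _ _ 0) //; last by move=> *; exact: Uh0.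
  rewrite -[leRHS]addr0 lerD ?f_lower ?(ltW (K_gt0 _)) //.
  by rewrite mulr_ge0_le0 // subr_le0 Uh_ge0.
- have /andP[ij' _] := ij.
  by rewrite Uh0 // UtK // g_bounds //; exact: node_time_QT_bd.
- by rewrite Uh_def // Ut_def //= !lexx.
Qed.
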